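(* Let $r\ge1$ be an integer, $k_1,\dots,k_r\in\mathbb{Z}$, $a,b,c$ positive reals and $n\ge 0$. Then $$B^{(k_1,\ldots,k_r)}_n(x;a,b,c)=\sum_{m_r>\cdots>m_1>0}\frac{1}{m_1^{k_1}m_2^{k_2}\cdots m_r^{k_r}}\sum_{j=0}^{m_r-r}(-1)^j\binom{m_r-r}{j}\bigl(rx\ln c-j\ln a-(j+r)\ln b\bigr)^n,$$ where the inner sum vanishes whenever $m_r-r>n$, so the outer sum has only finitely many nonzero terms.
   Context: For a positive integer $r$ and integers $k_1,\dots,k_r$, ${\rm Li}_{(k_1,\ldots,k_r)}(z)=\sum_{0<m_1<\cdots<m_r}\frac{z^{m_r}}{m_1^{k_1}\cdots m_r^{k_r}}$. For positive reals $a,b,c$, the generalized multi poly-Bernoulli polynomials are defined by $$\frac{{\rm Li}_{(k_1,\ldots,k_r)}(1-(ab)^{-t})}{(b^{t}-a^{-t})^r}c^{rxt}=\sum_{n=0}^{\infty}B^{(k_1,\ldots,k_r)}_n(x;a,b,c)\frac{t^n}{n!},$$ the left side being the formal power series $b^{-rt}c^{rxt}\,{\rm Li}_{(k_1,\ldots,k_r)}(z)/z^r$ with $z=1-(ab)^{-t}$. *)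

(* Defs.v *)
From HB Require Import structures.
From mathcomp Require Import all_boot all_order all_algebra.
From mathcomp Require Import mathcomp_extra boolp classical_sets cardinality.
From mathcomp Require Import fsbigop reals exp.

Set Implicit Arguments.
Unset Strict Implicit.
Unset Printing Implicit Defensive.

Import Order.TTheory GRing.Theory Num.Theory.

Local Open Scope classical_set_scope.
Local Open Scope ring_scope.

(* Formal power series over R, given by their coefficient sequences. *)
Definition fps (R : realType) := nat -> R.

Section FormalPowerSeries.
Variable R : realType.
Implicit Types f g : fps R.

Definition fps_one : fps R := fun n => (n == 0%N)%:R.

Definition fps_sub f g : fps R := fun n => f n - g n.

Definition fps_mul f g : fps R :=
  fun n => \sum_(i < n.+1) f i * g (n - i)%N.

Definition fps_exp f (d : nat) : fps R := iter d (fps_mul f) fps_one.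

(* The substitution f(g(t)), meaningful only when g 0 = 0: then g^i has order
   at least i, and the terms with i > n do not contribute to coefficient n. *)
Definition fps_comp f g : fps R :=
  fun n => \sum_(i < n.+1) f i * fps_exp g i n.

(* The quotient f(t) / t^d, meaningful only when f i = 0 for all i < d. *)
Definition fps_divX f (d : nat) : fps R := fun n => f (n + d)%N.

(* The expansion of u^(s t) = exp(s t ln u) in powers of t, for u > 0. *)
Definition fps_powR (u s : R) : fps R := fun n => (s * ln u) ^+ n / n`!%:R.

End FormalPowerSeries.

(* The chains 0 < m_1 < ... < m_r; the largest entry m_r is last 0 m. *)
Definition chains (r : nat) : set (r.-tuple nat) :=
  [set m : r.-tuple nat | path ltn 0%N m].
Arguments chains : clear implicits.

Section MultiPolyBernoulli.
Variables (R : realType) (r : nat) (k : r.-tuple int).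

Definition weight (m : r.-tuple nat) : R :=
  (\prod_(i < r) (tnth m i)%:R ^ (tnth k i))^-1.

(* The coefficient of z^N collects the chains with m_r = N. *)
Definition multiLi : fps R :=
  fun N => \sum_(m \in chains r `&` [set m | last 0%N m = N]) weight m.

Variables (a b c x : R).

(* z = 1 - (ab)^(-t) *)
Definition zseries : fps R := fps_sub (fps_one R) (fps_powR (a * b) (-1)).

(* b^(-rt) c^(rxt) Li(z) / z^r, where Li(z) / z^r is formed as a power series
   in the indeterminate z before substituting; this covers ab = 1, z = 0. *)
Definition genfun : fps R :=
  fps_mul (fps_mul (fps_powR b (- r%:R)) (fps_powR c (r%:R * x)))
          (fps_comp (fps_divX multiLi r) zseries).

Definition multi_poly_Bernoulli (n : nat) : R := n`!%:R * genfun n.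

Definition inner_sum (n : nat) (m : r.-tuple nat) : R :=
  \sum_(0 <= j < (last 0%N m - r).+1)
    (-1) ^+ j * 'C(last 0%N m - r, j)%:R
    * (r%:R * x * ln c - j%:R * ln a - (j + r)%:R * ln b) ^+ n.

End MultiPolyBernoulli.

(* The side conditions under which the total operations above have their
   intended meaning. *)

Lemma zseries0 (R : realType) (a b : R) : zseries a b 0%N = 0.
Proof. by rewrite /zseries /fps_sub /fps_one /fps_powR/= expr0 fact0 divr1 subrr. Qed.

Lemma path_ltn_last (s : seq nat) (p : nat) :
  path ltn p s -> (p + size s <= last p s)%N.
Proof.
elim: s p => [|q s IH] p /=; first by rewrite addn0.
by case/andP=> pq /IH; apply: leq_trans; rewrite addnS -addSn leq_add2r.
Qed.

Lemma path_ltn_mem (s : seq nat) (p : nat) :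
  path ltn p s -> all (fun q => (q <= last p s)%N) s.
Proof.
elim: s p => [//|q s IH] p /= /andP[_ pqs]; rewrite (IH _ pqs) andbT.
by apply: leq_trans (path_ltn_last pqs); rewrite leq_addr.
Qed.

Lemma finite_chains_last (r N : nat) :
  finite_set (chains r `&` [set m | last 0%N m = N]).
Proof.
pose h (f : r.-tuple 'I_N.+1) : r.-tuple nat := [tuple of map val f].
apply: (@sub_finite_set _ _ (h @` setT)); last first.
  exact/finite_image/finite_finset.
move=> m [/= pm lm]; exists [tuple of map inord m] => //.
apply: val_inj => /=; rewrite -map_comp -[RHS]map_id.
apply/eq_in_map => q qm /=; rewrite inordK// ltnS -lm.
by move/allP: (path_ltn_mem pm); apply.
Qed.

Lemma multiLi_lt (R : realType) (r : nat) (k : r.-tuple int) (N : nat) :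
  (N < r)%N -> multiLi R k N = 0.
Proof.
move=> Nr; rewrite /multiLi fsbig1// => m [/= pm lm]; move: Nr.
by have := path_ltn_last pm; rewrite size_tuple lm add0n leqNgt => /negbTE ->.
Qed.

(* Main.v *)
Require Import Defs.
From HB Require Import structures.
From mathcomp Require Import all_boot all_order all_algebra.
From mathcomp Require Import mathcomp_extra boolp classical_sets cardinality.
From mathcomp Require Import fsbigop reals exp.
From mathcomp Require Import ring.

(* Write E(u) for the power series of exp(u t).  Since E(u) E(v) = E(u + v),
   expanding z^d = (1 - E(w))^d with w = - ln (ab) binomially shows that n!
   times the coefficient of t^n in E(u) z^d is the alternating sum
   sum_j (-1)^j C(d, j) (u + j w)^n; for u = r x ln c - r ln b and d = m_r - r
   this is the inner sum.  It vanishes for d > n because z^d has order at least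
   d in t, and the formula follows by collecting the chains with the same m_r. *)

Import Order.TTheory GRing.Theory Num.Theory.

Local Open Scope classical_set_scope.
Local Open Scope ring_scope.

(** Pascal's rule splits each coefficient in two, and shifting the index in one half turns it into
    the terms in [g j.+1]. This is summation by parts for the step from z^d to z^(d+1). *)
Lemma sum_alternating_binS (R : comPzRingType) (d : nat) (g : nat -> R) :
  \sum_(j < d.+2) (-1) ^+ j * 'C(d.+1, j)%:R * g j =
  \sum_(j < d.+1) (-1) ^+ j * 'C(d, j)%:R * (g j - g j.+1).
Proof.
under [RHS]eq_bigr do rewrite mulrBr.
rewrite big_split/= big_ord_recl [in RHS]big_ord_recl/= !bin0 -addrA.
congr (_ + _); under eq_bigr do rewrite /bump/= add1n binS natrD mulrDr mulrDl.
rewrite big_split/=; congr (_ + _).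
  by rewrite big_ord_recr/= bin_small// mulr0 mul0r addr0.
by apply: eq_bigr => j _; rewrite exprS; ring.
Qed.

Section FormalPowerSeries.
Variable R : realType.
Implicit Types (f g : fps R) (u v w : R).

(** Indexed by the exponent instead of a base: [fps_powR b s] is convertible to
    [fps_expR (s * ln b)], so powers of different bases multiply by adding exponents. *)
Definition fps_expR u : fps R := fun n => u ^+ n / n`!%:R.

Lemma fps_expRD u v : fps_mul (fps_expR u) (fps_expR v) = fps_expR (u + v).
Proof.
apply/funext => n; rewrite /fps_mul /fps_expR addrC exprDn mulr_suml.
apply: eq_bigr => i _; have le_in : (i <= n)%N by rewrite -ltnS.
have nz m : m`!%:R != 0 :> R by rewrite pnatr_eq0 -lt0n fact_gt0.
rewrite -mulr_natr -(bin_fact le_in) !natrM; field.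
by rewrite !nz pnatr_eq0 -lt0n bin_gt0 le_in.
Qed.

Lemma fps_mul_sub1l f g :
  fps_mul (fps_sub (fps_one R) f) g = fps_sub g (fps_mul f g).
Proof.
apply/funext => n; rewrite /fps_mul /fps_sub /fps_one.
under eq_bigr do rewrite mulrBl.
rewrite big_split/= sumrN big_ord_recl/= subn0 mul1r big1 ?addr0// => i _.
by rewrite mul0r.
Qed.

Lemma fps_mul_sumr f (N : nat) (h : nat -> R) (g : nat -> fps R) (n : nat) :
  fps_mul f (fun l => \sum_(j < N) h j * g j l) n =
  \sum_(j < N) h j * fps_mul f (g j) n.
Proof.
rewrite /fps_mul; under eq_bigr do rewrite mulr_sumr.
rewrite exchange_big/=; apply: eq_bigr => j _; rewrite mulr_sumr.
by apply: eq_bigr => i _; rewrite mulrCA.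
Qed.

(** Induction on d: a further factor 1 - E(w) replaces each E(j w) by E(j w) - E((j + 1) w), and
    Pascal's rule regroups the differences. *)
Lemma fps_exp_sub1_expR w (d : nat) :
  fps_exp (fps_sub (fps_one R) (fps_expR w)) d =
  fun n => \sum_(j < d.+1) (-1) ^+ j * 'C(d, j)%:R * fps_expR (j%:R * w) n.
Proof.
elim: d => [|d IH].
  apply/funext => n; rewrite big_ord1/= bin0 !mul1r mul0r /fps_expR /fps_one.
  by rewrite expr0n; case: n => [|n]; rewrite ?fact0 ?divr1 ?mul0r.
rewrite {1}/fps_exp iterS -/(fps_exp _ d) IH fps_mul_sub1l.
apply/funext => n; rewrite /fps_sub.
rewrite (fps_mul_sumr _ _ (fun j => (-1) ^+ j * 'C(d, j)%:R)
  (fun j => fps_expR (j%:R * w))).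
rewrite (sum_alternating_binS _ _ (fun j => fps_expR (j%:R * w) n)) -sumrB.
apply: eq_bigr => j _; rewrite fps_expRD -mulrBr.
by rewrite -[j.+1]add1n natrD mulrDl mul1r.
Qed.

Lemma fps_exp_order f (d n : nat) :
  f 0%N = 0 -> (n < d)%N -> fps_exp f d n = 0.
Proof.
move=> f0; elim: d n => [//|d IH] n nd.
(* The term at index 0 dies because [f 0 = 0]; every other one involves a coefficient of
   [fps_exp f d] of index below d. *)
rewrite /fps_exp iterS -/(fps_exp f d) /fps_mul big1// => -[[|i] /= ltin] _.
  by rewrite f0 mul0r.
rewrite IH ?mulr0// -ltnS (leq_trans _ nd)// ltnS.
by rewrite ltn_subrL/= (leq_ltn_trans (leq0n i) ltin).
Qed.

(** [fps_comp] truncates at the coefficient index, here n - l, which varies along the product. As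
    h^i has order at least i, all truncations may be extended to the common bound n, and the two
    sums then commute. *)
Lemma fps_mul_comp f g h (n : nat) : h 0%N = 0 ->
  fps_mul f (fps_comp g h) n =
  \sum_(i < n.+1) g i * fps_mul f (fps_exp h i) n.
Proof.
move=> h0; rewrite -fps_mul_sumr /fps_mul; apply: eq_bigr => l _; congr (_ * _).
rewrite /fps_comp (big_ord_widen n.+1 (fun i => g i * fps_exp h i (n - l)%N)).
  rewrite big_mkcond; apply: eq_bigr => i _; case: ifPn => //.
  by rewrite -leqNgt => ltni; rewrite fps_exp_order ?mulr0.
by rewrite ltnS leq_subr.
Qed.

End FormalPowerSeries.

Section Fibers.
Variables (I : choiceType) (A : set I) (h : I -> nat).
Hypothesis finh : forall i, finite_set (A `&` [set m | h m = i]).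

Let fiberS n : A `&` [set m | (h m < n.+1)%N] =
  (A `&` [set m | (h m < n)%N]) `|` (A `&` [set m | h m = n]).
Proof.
rewrite -setIUr; congr (_ `&` _); apply/seteqP; split => m /=.
  by rewrite ltnS leq_eqVlt => /orP[/eqP|]; [right|left].
by case=> [/ltnW//|->].
Qed.

Lemma finite_fibers_lt n : finite_set (A `&` [set m | (h m < n)%N]).
Proof.
elim: n => [|n IH]; first by apply: (sub_finite_set _ (finite_set0 I)) => m [].
by rewrite fiberS finite_setU; split.
Qed.

Lemma fsumr_fibers_lt (V : nmodType) (F : I -> V) n :
  \sum_(m \in A `&` [set m | (h m < n)%N]) F m =
  \sum_(i < n) \sum_(m \in A `&` [set m | h m = i]) F m.
Proof.
elim: n => [|n IH]; first by rewrite big_ord0 fsbig1// => m [].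
rewrite big_ord_recr/= -IH fiberS fsbigU0//; first exact: finite_fibers_lt.
by move=> m [[_ /= hm] [_ /= hmn]]; move: hm; rewrite hmn ltnn.
Qed.

End Fibers.

(** The truncated subtraction loses nothing, since a chain of r positive integers has last entry at
    least r. The shift by r is the one in [fps_divX]. *)
Lemma chains_last_fiber (r i : nat) :
  chains r `&` [set m | (last 0 m - r)%N = i] =
  chains r `&` [set m | last 0%N m = (i + r)%N].
Proof.
apply/seteqP; split => m [/= pm lm]; split=> //=; last by rewrite lm addnK.
by rewrite -lm subnK// -{1}(size_tuple m) -[size m]add0n path_ltn_last.
Qed.

Section InnerSum.
Variables (R : realType) (r : nat) (a b c x : R).
Hypotheses (a0 : 0 < a) (b0 : 0 < b).

Lemma inner_sum_coef (n : nat) (m : r.-tuple nat) :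
  inner_sum a b c x n m =
  n`!%:R * fps_mul (fps_expR _ (- r%:R * ln b + r%:R * x * ln c))
                   (fps_exp (zseries a b) (last 0%N m - r)) n.
Proof.
rewrite /inner_sum /zseries -/(fps_expR _ (-1 * ln (a * b))) fps_exp_sub1_expR.
rewrite (fps_mul_sumr _ _ _ (fun j => (-1) ^+ j * 'C(last 0%N m - r, j)%:R)
  (fun j => fps_expR _ (j%:R * (-1 * ln (a * b))))).
rewrite big_mkord mulr_sumr; apply: eq_bigr => j _.
(* Positivity of a and b splits ln (ab), and the exponent becomes r x ln c - j ln a - (j + r) ln
   b. *)
rewrite fps_expRD /fps_expR lnM ?posrE// mulrCA; congr (_ * _).
rewrite [RHS]mulrC divfK ?pnatr_eq0 -?lt0n ?fact_gt0// natrD.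
by congr (_ ^+ _); ring.
Qed.

Lemma inner_sum_eq0 (n : nat) (m : r.-tuple nat) :
  (n < last 0%N m - r)%N -> inner_sum a b c x n m = 0.
Proof.
move=> nm; rewrite inner_sum_coef /fps_mul big1 ?mulr0// => i _.
rewrite fps_exp_order ?mulr0 ?zseries0//.
exact: leq_ltn_trans (leq_subr _ _) nm.
Qed.

End InnerSum.

Theorem theorem2p2 (R : realType) (r : nat) (k : r.-tuple int)
    (a b c x : R) (n : nat) :
  (0 < r)%N -> 0 < a -> 0 < b -> 0 < c ->
  [/\ multi_poly_Bernoulli k a b c x n =
        \sum_(m \in chains r) weight R k m * inner_sum a b c x n m,
      forall m : r.-tuple nat, chains r m -> (n < last 0%N m - r)%N ->
        inner_sum a b c x n m = 0
    & finite_set [set m : r.-tuple nat |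
        chains r m /\ weight R k m * inner_sum a b c x n m <> 0]].
Proof.
move=> _ a0 b0 _.
pose h (m : r.-tuple nat) := (last 0%N m - r)%N.
have finh i : finite_set (chains r `&` [set m | h m = i]).
  by rewrite chains_last_fiber; exact: finite_chains_last.
split=> [|m _|]; last 2 first.
- exact: inner_sum_eq0.
(* A nonzero term forces m_r - r <= n, which leaves finitely many chains; hence the sum over
   [chains r] is a genuine one and not the default value 0. *)
- apply: (sub_finite_set _ (finite_fibers_lt _ _ _ finh n.+1)) => m [/= cm nz].
  split=> //=; rewrite ltnS leqNgt; apply/negP => nm; apply: nz.
  by rewrite inner_sum_eq0 ?mulr0.
(* The vanishing terms are dropped so that the remaining chains can be grouped by i = m_r - r <= n,
   the exponent of z in Li(z) / z^r. *)
transitivity (\sum_(m \in chains r `&` [set m | (h m < n.+1)%N])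
  weight R k m * inner_sum a b c x n m); last first.
  apply: fsbig_widen => [m []//|m [/= cm /not_andP[//|/= /negP]]].
  by rewrite -leqNgt => nm; rewrite inner_sum_eq0 ?mulr0.
rewrite fsumr_fibers_lt// /multi_poly_Bernoulli /genfun.
rewrite /fps_powR -/(fps_expR _ (- r%:R * ln b)) -/(fps_expR _ (r%:R * x * ln c)).
rewrite fps_expRD fps_mul_comp ?zseries0// mulr_sumr.
apply: eq_bigr => i _; rewrite mulrCA /fps_divX /multiLi -chains_last_fiber.
rewrite mulr_fsuml; apply: eq_fsbigr => m; rewrite inE => -[_ /= hm].
by rewrite inner_sum_coef// hm.
Qed.
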